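(* Let $\mathbf{A} = \langle A, \to, 0\rangle$ be an implicator groupoid. The following are equivalent: (1) $\mathbf{A^{mj}}$ is a lattice (i.e. $\langle A, \land, \lor\rangle$ is a lattice); (2) the absorption law $x \land (x \lor y) \approx x$ holds in $\mathbf{A^{mj}}$; (3) $(x \to y) \to x \approx x$ holds in $\mathbf{A}$; (4) $\mathbf{A}$ is a De Morgan algebra.
   Context: An implicator groupoid is an algebra $\mathbf A = \langle A, \to, 0 \rangle$, with $\to$ binary and $0$ a constant, which, writing $x' := x \to 0$, satisfies the identities (I) $(x \to y) \to z \approx [(z' \to x) \to (y \to z)']'$ and (I$_0$) $0'' \approx 0$. Put $x \land y := (x \to y')'$ and $x \lor y := (x' \land y')'$, and let $\mathbf{A^{mj}} := \langle A, \land, \lor, 0 \rangle$. Following the paper, an implicator groupoid is called a De Morgan algebra if it satisfies $(x \to y) \to x \approx x$. *)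

(* Defs.v *)
From mathcomp Require Import all_boot.

Set Implicit Arguments.
Unset Strict Implicit.
Unset Printing Implicit Defensive.

Declare Scope implicator_scope.
Delimit Scope implicator_scope with imp.

Reserved Notation "x ~> y" (at level 55, right associativity).
Reserved Notation "x /^\ y" (at level 48, left associativity).
Reserved Notation "x \v/ y" (at level 50, left associativity).

Record groupoid0 := Groupoid0 {
  carrier :> Type;
  imp : carrier -> carrier -> carrier;
  zero : carrier
}.

Arguments zero {_}.
Notation "x ~> y" := (imp x y) : implicator_scope.

Local Open Scope implicator_scope.

Definition neg (A : groupoid0) (x : A) : A := x ~> zero.
Notation "x ^'" := (neg x) : implicator_scope.

Definition meet (A : groupoid0) (x y : A) : A := (x ~> y^')^'.
Notation "x /^\ y" := (meet x y) : implicator_scope.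

Definition join (A : groupoid0) (x y : A) : A := (x^' /^\ y^')^'.
Notation "x \v/ y" := (join x y) : implicator_scope.

Record is_implicator_groupoid (A : groupoid0) : Prop := IsImplicatorGroupoid {
  implicator_I : forall x y z : A,
    (x ~> y) ~> z = ((z^' ~> x) ~> (y ~> z)^')^';
  implicator_I0 : (zero : A)^'^' = zero
}.

Definition is_de_morgan_algebra (A : groupoid0) : Prop :=
  is_implicator_groupoid A /\ forall x y : A, (x ~> y) ~> x = x.

(* Equational lattices on a bare type: MathComp's [latticeType] would require
   choice and a prescribed order on the carrier. *)
Record is_lattice (T : Type) (m j : T -> T -> T) : Prop := IsLattice {
  lattice_meetC : commutative m;
  lattice_joinC : commutative j;
  lattice_meetA : associative m;
  lattice_joinA : associative j;
  lattice_meetxx : idempotent_op m;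
  lattice_joinxx : idempotent_op j;
  lattice_joinKI : forall x y : T, m x (j x y) = x;
  lattice_meetKU : forall x y : T, j x (m x y) = x
}.

(* Main.v *)
Require Import Defs.
From mathcomp Require Import all_boot.

Local Open Scope implicator_scope.

(** The proof rests on the instances of (I) at a zero argument.  At [y = 0] it reads
    [x^' ~> z = ((z^' ~> x) ~> (0 ~> z)^')^'], so once [(0 ~> z)^' = 0] is known
    it becomes [x^' ~> z = (z^' ~> x)^'^'].  When negation is moreover an
    involution, this is contraposition ([imp_swap]), i.e. commutativity of the
    join [x \v/ y = x^' ~> y].

    From the absorption law: absorption exhibits each element as a complement,
    and its instance at [0] then gives [(0 ~> z)^' = 0].  The displayed identity
    yields [0^' ~> z = z^'^'^'^'], from which negation is seen to have order
    dividing 4; then [0^'] is a left unit, and (I) at [z = 0] brings the order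
    down to 2 ([absorption_negK]).  Contraposition turns absorption into
    [(x ~> y) ~> x = x].

    From [(x ~> y) ~> x = x]: its instances at [0] give [(0 ~> z)^' = 0] and then
    the involution law.  The De Morgan laws now hold by definition, both absorption
    laws are contraposed forms of the hypothesis, and (I) itself says that join
    distributes over meet.  Idempotence follows from absorption, and
    associativity holds in every commutative structure with absorption in which
    meet distributes over join ([absorptive_distributive_joinA]); De Morgan duality
    supplies the second distributive law, hence associativity of both operations. *)

(** Both bracketings [l] and [r] of a triple join lie above each of the three
    elements, in the sense that meeting with [l] or [r] fixes them;
    distributivity then gives [l = m l r = r]. *)
Lemma absorptive_distributive_joinA (T : Type) (m j : T -> T -> T) :
  commutative m -> commutative j ->
  (forall x y, m x (j x y) = x) -> (forall x y, j x (m x y) = x) ->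
  left_distributive m j -> associative j.
Proof.
move=> mC jC mK jK mDj x y z.
have mKr u v : m u (j v u) = u by rewrite jC mK.
have below_l u v w : m u (j (j u v) w) = u by rewrite mC mDj mC mK mC jK.
have below_r u v w : m u (j w (j u v)) = u by rewrite jC below_l.
set r := j x (j y z); set l := j (j x y) z.
have m_rl : m r l = r.
  rewrite {1}/r !mDj /l below_l mKr.
  by rewrite (jC x y) below_l.
have m_lr : m l r = l.
  rewrite {1}/l !mDj /r mK below_r.
  by rewrite (jC y z) below_r.
by rewrite -m_rl mC m_lr.
Qed.

Section ImplicatorGroupoid.

Variables (A : groupoid0) (hA : is_implicator_groupoid A).

Notation "0" := (@zero A).

Let impI (x y z : A) : (x ~> y) ~> z = ((z^' ~> x) ~> (y ~> z)^')^'.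
Proof. exact: implicator_I. Qed.

Let neg00 : 0^'^' = 0.
Proof. exact: implicator_I0. Qed.

(** Identity (I) at [z = 0]. *)
Lemma neg_imp (x y : A) : (x ~> y)^' = ((0^' ~> x) ~> y^'^')^'.
Proof. exact: impI. Qed.

(** Double negation cannot see a left factor [0^']: (I) at [y = z = 0]. *)
Lemma neg_neg_unit (x : A) : (0^' ~> x)^'^' = x^'^'.
Proof. by rewrite [RHS]neg_imp neg00. Qed.

(** Identity (I) at [y = 0]. *)
Lemma neg_imp_swap :
  (forall y : A, (0 ~> y)^' = 0) ->
  forall x z : A, x^' ~> z = (z^' ~> x)^'^'.
Proof. by move=> neg0imp x z; rewrite {1}/neg impI neg0imp. Qed.

Lemma imp_swap :
  (forall y : A, (0 ~> y)^' = 0) -> involutive (@neg A) ->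
  forall x z : A, x^' ~> z = z^' ~> x.
Proof. by move=> neg0imp negK x z; rewrite neg_imp_swap // negK. Qed.

Lemma imp_negr_swap :
  (forall y : A, (0 ~> y)^' = 0) -> involutive (@neg A) ->
  forall x z : A, x ~> z^' = z ~> x^'.
Proof.
by move=> neg0imp negK x z; rewrite -{1}(negK x) imp_swap // negK.
Qed.

Section FromAbsorption.

Hypothesis meet_joinK : forall x y : A, x /^\ (x \v/ y) = x.

Lemma absorption_neg_surj (x : A) : exists w : A, x = w^'.
Proof. by exists (x ~> (x \v/ 0)^'); rewrite -[LHS](meet_joinK x 0). Qed.

(** The instance at [0] of absorption only speaks of elements
    [y^'^'^'^'^'], which by surjectivity of negation are all elements. *)
Lemma absorption_neg0imp (y : A) : (0 ~> y)^' = 0.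
Proof.
have [y1 ->] := absorption_neg_surj y; have [y2 ->] := absorption_neg_surj y1.
have [y3 ->] := absorption_neg_surj y2; have [y4 ->] := absorption_neg_surj y3.
have [y5 ->] := absorption_neg_surj y4.
have := meet_joinK 0 y5.
by rewrite /join {1 2}/meet neg_neg_unit.
Qed.

(** Negation satisfies [x^'^' = x^'^'^'^'^'^'], and surjectivity
    cancels two of these negations on each side. *)
Lemma absorption_negK : involutive (@neg A).
Proof.
have unit0 z : 0^' ~> z = z^'^'^'^'.
  by rewrite neg_imp_swap //; exact: absorption_neg0imp.
have neg6 (x : A) : x^'^' = x^'^'^'^'^'^'.
  by rewrite -[LHS]neg_neg_unit unit0.
have neg4 (x : A) : x^'^'^'^' = x.
  have [w ->] := absorption_neg_surj x; have [v ->] := absorption_neg_surj w.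
  by rewrite -neg6.
have {}unit0 z : 0^' ~> z = z by rewrite unit0 neg4.
move=> y; have neg_inj : injective (@neg A).
  by move=> u v uv; rewrite -(neg4 u) uv neg4.
(* (I) at [z = 0] with left unit [0^'] reads [(x ~> y)^' = (x ~> y^'^')^'];
   take [x = 0^']. *)
by apply: neg_inj; rewrite -{2}(unit0 y) neg_imp !unit0.
Qed.

Lemma absorption_de_morgan (x y : A) : (x ~> y) ~> x = x.
Proof.
have negK := absorption_negK.
have := meet_joinK x^' y.
rewrite /join /meet !negK => /(congr1 (@neg A)).
by rewrite !negK imp_negr_swap ?negK //; exact: absorption_neg0imp.
Qed.

End FromAbsorption.

Section FromDeMorgan.

Hypothesis impK : forall x y : A, (x ~> y) ~> x = x.

Lemma de_morgan_neg0imp (y : A) : (0 ~> y)^' = 0.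
Proof. exact: impK. Qed.

(** Expand [x^' ~> x = x] by (I) at [y = 0]. *)
Lemma de_morgan_negK : involutive (@neg A).
Proof.
move=> x; rewrite -{2}(impK x 0) impI de_morgan_neg0imp.
by rewrite [_ ~> x](impK x 0).
Qed.

Let negK := de_morgan_negK.

Lemma de_morgan_joinE (x y : A) : x \v/ y = x^' ~> y.
Proof. by rewrite /join /meet !negK. Qed.

Lemma de_morgan_neg_meet (x y : A) : (x /^\ y)^' = x^' \v/ y^'.
Proof. by rewrite /join !negK. Qed.

Lemma de_morgan_neg_join (x y : A) : (x \v/ y)^' = x^' /^\ y^'.
Proof. exact: negK. Qed.

Lemma de_morgan_joinC : commutative (@join A).
Proof.
move=> x y; rewrite !de_morgan_joinE; apply: imp_swap negK x y.
exact: de_morgan_neg0imp.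
Qed.

Lemma de_morgan_meetC : commutative (@meet A).
Proof.
move=> x y; rewrite /meet; congr neg; apply: imp_negr_swap negK x y.
exact: de_morgan_neg0imp.
Qed.

Lemma de_morgan_joinKI (x y : A) : x /^\ (x \v/ y) = x.
Proof.
rewrite /meet de_morgan_joinE imp_negr_swap ?impK ?negK //.
exact: de_morgan_neg0imp.
Qed.

Lemma de_morgan_meetKU (x y : A) : x \v/ (x /^\ y) = x.
Proof. by rewrite de_morgan_joinC de_morgan_joinE /meet negK impK. Qed.

(** This is (I), read through [x ~> y = x^' \v/ y]. *)
Lemma de_morgan_join_distrl : left_distributive (@join A) (@meet A).
Proof.
move=> x y z; rewrite (de_morgan_joinC x z) !de_morgan_joinE.
by rewrite [in LHS]/meet negK impI.
Qed.

Lemma de_morgan_meet_distrl : left_distributive (@meet A) (@join A).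
Proof.
move=> x y z; apply: (can_inj negK).
rewrite de_morgan_neg_join !de_morgan_neg_meet de_morgan_neg_join.
exact: de_morgan_join_distrl.
Qed.

Lemma de_morgan_is_lattice : is_lattice (@meet A) (@join A).
Proof.
split.
- exact: de_morgan_meetC.
- exact: de_morgan_joinC.
- exact: (absorptive_distributive_joinA _ _ _ de_morgan_joinC de_morgan_meetC
            de_morgan_meetKU de_morgan_joinKI de_morgan_join_distrl).
- exact: (absorptive_distributive_joinA _ _ _ de_morgan_meetC de_morgan_joinC
            de_morgan_joinKI de_morgan_meetKU de_morgan_meet_distrl).
- by move=> x; rewrite -{2}(de_morgan_meetKU x x) de_morgan_joinKI.
- by move=> x; rewrite -{2}(de_morgan_joinKI x x) de_morgan_meetKU.
- exact: de_morgan_joinKI.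
- exact: de_morgan_meetKU.
Qed.

End FromDeMorgan.

End ImplicatorGroupoid.

(* MathComp world *)
Theorem theorem6p3 (A : groupoid0) (hA : is_implicator_groupoid A) :
  [<-> is_lattice (@meet A) (@join A);
       forall x y : A, x /^\ (x \v/ y) = x;
       forall x y : A, (x ~> y) ~> x = x;
       is_de_morgan_algebra A].
Proof.
tfae.
- exact: lattice_joinKI.
- exact: absorption_de_morgan.
- by [].
- by case=> _; exact: de_morgan_is_lattice.
Qed.
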